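(* Let $L_1,L_2,L_3>0$, $k_{ap}>0$, $k_{ad}>0$ be given, and let $f\in\mathcal F$ (the class with constants $L_1,L_2,L_3$). Consider the closed-loop system consisting of the plant $$\dot x_1=x_2,\qquad \dot x_2=f(x_1,x_2,t)+u(t),$$ the observer $$\dot\xi=-\omega_o\xi-\omega_o^2x_2-\omega_o u,\quad \xi(0)=-\omega_o x_2(0),\qquad \hat f=\xi+\omega_o x_2,$$ and the control law $$u=-k_{ap}(x_1-r)-k_{ad}(x_2-\dot r)-\hat f+\ddot r .$$ If $\omega_o>\omega_o^*$, where $\omega_o^*=\omega_o^*(L_1,L_2,k_{ap},k_{ad})$ is the explicit constant defined in the context, then for any initial value $(x_1(0),x_2(0))\in\mathbb R^2$ and any $y^{**}\in\mathbb R$ (the limit of the reference signal $y^*$), $$\lim_{t\to\infty}x_1(t)=y^{**},\qquad \lim_{t\to\infty}x_2(t)=0 .$$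
   Context: Reference signal: $y^*(t)$ is a given bounded, twice differentiable real signal on $[0,\infty)$ with $\lim_{t\to\infty}y^*(t)=y^{**}$ (a constant), $\lim_{t\to\infty}\dot y^*(t)=0$, $\lim_{t\to\infty}\ddot y^*(t)=0$. Desired transient process: $r$ is the solution of the stable linear filter $\ddot r=-2c_r\dot r-c_r^2(r-y^*(t))$, $r(0)=x_1(0)$, $\dot r(0)=x_2(0)$, with a parameter $c_r>0$. Function class: for positive constants $L_1,L_2,L_3$, $$\mathcal F=\Big\{f\in C^1(\mathbb R^2\times\mathbb R^+)\ \Big|\ f(x_1,x_2,t)=h(x_1,x_2)+w(t),\ \Big|\tfrac{\partial h}{\partial x_1}\Big|\le L_1,\ \Big|\tfrac{\partial h}{\partial x_2}\Big|\le L_2,\ |w(t)|\le L_3,\ |\dot w(t)|\le L_3,\ \lim_{t\to\infty}w(t)\text{ exists},\ \forall x_1,x_2\in\mathbb R,\ \forall t\in\mathbb R^+\Big\},$$ where $C^1(\mathbb R^2\times\mathbb R^+)$ denotes the functions $\mathbb R^2\times\mathbb R^+\to\mathbb R$ that are continuous in $(x_1,x_2)$ and $t$, with continuous partial derivatives with respect to $(x_1,x_2)$. The constant $\omega_o^*$: let $$\Omega=\{\omega\in\mathbb R \mid n_0\omega^4+n_1\omega^3+n_2\omega^2+n_3\omega+n_4=0\},$$ with $n_0=k_{ad}^2$, $n_1=2k_{ad}[k_{ad}(k_{ad}-L_2)-L_1]$, $n_2=2k_{ad}(k_{ap}-L_1)(k_{ad}-L_2)+[k_{ad}(k_{ad}-L_2)-L_1]^2-L_2^2k_{ap}$,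 $n_3=2[k_{ad}(k_{ad}-L_2)-L_1](k_{ap}-L_1)(k_{ad}-L_2)-L_2^2k_{ap}(k_{ad}-L_2)$, $n_4=(k_{ap}-L_1)^2(k_{ad}-L_2)^2$. Put $\bar\omega_o=0$ if $\Omega=\varnothing$ or $\max\Omega\le 0$, and $\bar\omega_o=\max\Omega$ if $\max\Omega>0$. Then $$\omega_o^*=\max\Big\{0,\ \frac{L_1-k_{ap}}{k_{ad}},\ L_2-k_{ad},\ \bar\omega_o\Big\}.$$ *)

(* Defs.v *)
From Stdlib Require Import Reals ClassicalEpsilon.
From Coquelicot Require Import Coquelicot.
Open Scope R_scope.

Definition Rplus_dom (t : R) : Prop := 0 <= t.

(* Signals on [0, oo) are functions on R of which only the values at t >= 0
   matter; [D_in] makes the derivative at 0 the right derivative. *)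
Definition derivative_on_Rplus (g g' : R -> R) : Prop :=
  forall t, 0 <= t -> D_in g g' Rplus_dom t.

Definition reference_signal (y : R -> R) (yss : R) : Prop :=
  (exists M, forall t, 0 <= t -> Rabs (y t) <= M) /\
  is_lim y p_infty yss /\
  exists dy ddy : R -> R,
    derivative_on_Rplus y dy /\ derivative_on_Rplus dy ddy /\
    is_lim dy p_infty 0 /\ is_lim ddy p_infty 0.

Definition transient_process (cr : R) (y : R -> R) (x10 x20 : R)
    (r dr ddr : R -> R) : Prop :=
  derivative_on_Rplus r dr /\ derivative_on_Rplus dr ddr /\
  (forall t, 0 <= t -> ddr t = - 2 * cr * dr t - cr ^ 2 * (r t - y t)) /\
  r 0 = x10 /\ dr 0 = x20.

(* Functions on R^2 x R^+ are curried functions on R^3 of which only the values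
   at t >= 0 matter. *)
Definition continuous_R2Rplus (g : R -> R -> R -> R) : Prop :=
  continuous_on (fun p : R * R * R => 0 <= snd p)
    (fun p : R * R * R => g (fst (fst p)) (snd (fst p)) (snd p)).

Definition C1_R2Rplus (f : R -> R -> R -> R) : Prop :=
  continuous_R2Rplus f /\
  (forall x1 x2 t, 0 <= t ->
     ex_derive (fun z => f z x2 t) x1 /\ ex_derive (fun z => f x1 z t) x2) /\
  continuous_R2Rplus (fun x1 x2 t => Derive (fun z => f z x2 t) x1) /\
  continuous_R2Rplus (fun x1 x2 t => Derive (fun z => f x1 z t) x2).

Definition class_F (L1 L2 L3 : R) (f : R -> R -> R -> R) : Prop :=
  C1_R2Rplus f /\
  exists (h : R -> R -> R) (w dw : R -> R),
    (forall x1 x2 t, 0 <= t -> f x1 x2 t = h x1 x2 + w t) /\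
    (forall x1 x2, ex_derive (fun z => h z x2) x1 /\
                   Rabs (Derive (fun z => h z x2) x1) <= L1) /\
    (forall x1 x2, ex_derive (fun z => h x1 z) x2 /\
                   Rabs (Derive (fun z => h x1 z) x2) <= L2) /\
    derivative_on_Rplus w dw /\
    (forall t, 0 <= t -> Rabs (w t) <= L3 /\ Rabs (dw t) <= L3) /\
    ex_finite_lim w p_infty.

Definition n0 (L1 L2 kap kad : R) : R := kad ^ 2.
Definition n1 (L1 L2 kap kad : R) : R :=
  2 * kad * (kad * (kad - L2) - L1).
Definition n2 (L1 L2 kap kad : R) : R :=
  2 * kad * (kap - L1) * (kad - L2) + (kad * (kad - L2) - L1) ^ 2
  - L2 ^ 2 * kap.
Definition n3 (L1 L2 kap kad : R) : R :=
  2 * (kad * (kad - L2) - L1) * (kap - L1) * (kad - L2)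
  - L2 ^ 2 * kap * (kad - L2).
Definition n4 (L1 L2 kap kad : R) : R :=
  (kap - L1) ^ 2 * (kad - L2) ^ 2.

Definition Omega (L1 L2 kap kad : R) (w : R) : Prop :=
  n0 L1 L2 kap kad * w ^ 4 + n1 L1 L2 kap kad * w ^ 3
  + n2 L1 L2 kap kad * w ^ 2 + n3 L1 L2 kap kad * w + n4 L1 L2 kap kad = 0.

Definition is_max (E : R -> Prop) (m : R) : Prop := E m /\ is_upper_bound E m.

(* The maximum of [E]; unspecified when [E] has none. [Omega] has one when it is
   nonempty and [kad <> 0], being then the root set of a quartic. *)
Definition max_set (E : R -> Prop) : R := epsilon (inhabits 0) (is_max E).

Definition omega_bar (L1 L2 kap kad : R) : R :=
  if excluded_middle_informative
       ((forall w, ~ Omega L1 L2 kap kad w) \/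
        max_set (Omega L1 L2 kap kad) <= 0)
  then 0
  else max_set (Omega L1 L2 kap kad).

Definition omega_star (L1 L2 kap kad : R) : R :=
  Rmax 0 (Rmax ((L1 - kap) / kad)
               (Rmax (L2 - kad) (omega_bar L1 L2 kap kad))).

Definition plant (f : R -> R -> R -> R) (u x1 x2 : R -> R) : Prop :=
  derivative_on_Rplus x1 x2 /\
  derivative_on_Rplus x2 (fun t => f (x1 t) (x2 t) t + u t).

Definition observer (wo : R) (x2 u xi fhat : R -> R) : Prop :=
  derivative_on_Rplus xi
    (fun t => - wo * xi t - wo ^ 2 * x2 t - wo * u t) /\
  xi 0 = - wo * x2 0 /\
  (forall t, 0 <= t -> fhat t = xi t + wo * x2 t).

Definition control_law (kap kad : R) (x1 x2 r dr ddr fhat u : R -> R) : Prop :=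
  forall t, 0 <= t ->
    u t = - kap * (x1 t - r t) - kad * (x2 t - dr t) - fhat t + ddr t.

(* Main.v *)
Require Import Defs.
From Stdlib Require Import Reals Lra ClassicalEpsilon Classical.
From Coquelicot Require Import Coquelicot.
Open Scope R_scope.

(** The observer and the control law together are a PID controller. Write
    [Y = x1 - r] and [V = x2 - dr]. Since [fhat' = wo (f - fhat)] and
    [V' = - kap Y - kad V + f - fhat], the quantity [fhat - wo V - wo kad Y] has
    derivative [wo kap Y]; suitably shifted and scaled, it is an integral [X] of
    [Y], and the closed loop reads

      X' = Y,  Y' = V,  V' = - c X - g(Y) - (kad + wo) V + b + d

    with [c = wo kap] and
    [g(Y) = (kap + wo kad) Y - (h(yss + Y, 0) - h(yss, 0))]. The velocity
    dependence [b = h(yss + Y, V) - h(yss + Y, 0)] is bounded by [L2 |V|], and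
    [d] collects what tends to 0: the distance of [(r, dr)] to [(yss, 0)] and the
    distance of [w] to its limit.

    Put [p = kap + wo kad - L1] and [q = kad + wo - L2]. Then [y g(y) >= p y^2],
    and [wo > omega_star] gives [p, q > 0], [p q > c] and
    [(p q - c)^2 > L2^2 c q], because the quartic defining the threshold is the
    difference of the two sides of the last inequality as a function of [wo]
    ([omega_star_conditions]).

    These inequalities are exactly what provides a multiplier [mu] with
    [4 (mu p - c) (q - mu) > (L2 mu)^2] ([multiplier_exists]). With it the
    classical Lyapunov function of third-order equations, plus a small multiple
    of [X V], is comparable to [X^2 + Y^2 + V^2] ([lyapunov_bounds]) and has a
    derivative at most [- k (X^2 + Y^2 + V^2) + C d^2]
    ([lyapunov_rate_bound]). A scalar comparison argument
    ([decay_eventually_le]) then sends [Y] and [V] to 0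
    ([third_order_convergence]). The same argument shows
    that [r] tends to [yss] and [dr] to 0, so [x1] tends to [yss] and [x2]
    to 0. *)

(** * Calculus on half-lines *)

Lemma MVT_between (F dF : R -> R) (a b : R) :
  (forall z, Rmin a b <= z <= Rmax a b -> is_derive F z (dF z)) ->
  exists z, Rmin a b <= z <= Rmax a b /\ F b - F a = dF z * (b - a).
Proof.
intros H.
destruct (MVT_gen F a b dF) as [z [Hz E]].
- intros z Hz; apply H; lra.
- intros z Hz; apply derivable_continuous_pt.
  exists (dF z); apply is_derive_Reals, H, Hz.
- exists z; split; assumption.
Qed.

Lemma eventually_small (eta : R -> R) (e : R) :
  is_lim eta p_infty 0 -> 0 < e ->
  exists T, 0 < T /\ forall t, T < t -> Rabs (eta t) < e.
Proof.
intros H He.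
apply is_lim_spec in H.
destruct (H (mkposreal e He)) as [T HT].
exists (Rmax 1 T); split.
- apply Rlt_le_trans with 1; [lra | apply Rmax_l].
- intros t Ht; pose proof (Rmax_r 1 T).
  specialize (HT t ltac:(lra)); simpl in HT.
  now rewrite Rminus_0_r in HT.
Qed.

Lemma is_lim_0_of_eventually_small (g : R -> R) :
  (forall e, 0 < e -> exists T, forall t, T < t -> Rabs (g t) < e) ->
  is_lim g p_infty 0.
Proof.
intros H; apply is_lim_spec; intros [e He]; simpl.
destruct (H e He) as [T HT]; exists T; intros t Ht.
rewrite Rminus_0_r; now apply HT.
Qed.

(** Only an interior point allows this: at 0 the one-sided derivative says
    nothing about the values on the left. *)
Lemma derivative_on_Rplus_is_derive (g g' : R -> R) (t : R) :
  derivative_on_Rplus g g' -> 0 < t -> is_derive g t (g' t).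
Proof.
intros H Ht; apply is_derive_Reals.
specialize (H t (Rlt_le _ _ Ht)).
unfold D_in, limit1_in, limit_in in H; simpl in H.
intros e He; destruct (H e He) as [a [Ha Hd]].
assert (Hm : 0 < Rmin a t) by (apply Rmin_pos; lra).
exists (mkposreal _ Hm); intros s Hs0 Hs; simpl in Hs.
pose proof (Rmin_l a t); pose proof (Rmin_r a t).
specialize (Hd (t + s)).
unfold Rdist in Hd; replace (t + s - t) with s in Hd by ring.
apply Hd; split; [split | ]; [ | intro; apply Hs0; lra | lra].
unfold Rplus_dom; apply Rabs_def2 in Hs; lra.
Qed.

Lemma lipschitz_of_derive_bound (F : R -> R) (L : R) :
  (forall z, ex_derive F z /\ Rabs (Derive F z) <= L) ->
  forall a b, Rabs (F b - F a) <= L * Rabs (b - a).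
Proof.
intros H a b.
destruct (MVT_between F (Derive F) a b) as [z [_ E]].
- intros z _; apply Derive_correct, H.
- rewrite E, Rabs_mult.
  apply Rmult_le_compat_r; [apply Rabs_pos | apply H].
Qed.

Lemma is_lim_sub_const (g : R -> R) (l : R) :
  is_lim g p_infty l -> is_lim (fun t => g t - l) p_infty 0.
Proof.
intro H; replace (Finite 0) with (Finite (l - l)) by (f_equal; ring).
apply is_lim_minus'; [exact H | apply is_lim_const].
Qed.

Lemma is_lim_scal_0 (k : R) (g : R -> R) :
  is_lim g p_infty 0 -> is_lim (fun t => k * g t) p_infty 0.
Proof.
intro H; replace (Finite 0) with (Rbar_mult k 0) by (simpl; f_equal; ring).
now apply is_lim_scal_l.
Qed.

Lemma is_lim_abs_le_0 (g b : R -> R) :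
  (forall t, 0 < t -> Rabs (g t) <= b t) -> is_lim b p_infty 0 ->
  is_lim g p_infty 0.
Proof.
intros H Hb; apply is_lim_0_of_eventually_small; intros e He.
destruct (eventually_small b e Hb He) as [T [HT0 HT]].
exists T; intros t Ht.
eapply Rle_lt_trans; [apply H; lra | ].
eapply Rle_lt_trans; [apply Rle_abs | now apply HT].
Qed.

(** * Comparison with a stable first-order equation *)

(** Once [eta] is below [k * e / 2], the function [exp (k t) * (W t - e / 2)] no
    longer increases, so [W - e / 2] is bounded by a decaying exponential. *)
Lemma decay_eventually_le (W dW eta : R -> R) (k : R) :
  0 < k ->
  (forall t, 0 < t -> is_derive W t (dW t)) ->
  (forall t, 0 < t -> dW t <= - k * W t + eta t) ->
  is_lim eta p_infty 0 ->
  forall e, 0 < e -> exists T, forall t, T < t -> W t < e.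
Proof.
intros Hk HW Hle Heta e He.
destruct (eventually_small eta (k * (e / 2)) Heta) as [T [HT0 HT]].
{ apply Rmult_lt_0_compat; lra. }
set (T1 := T + 1).
set (A := Rabs (W T1 - e / 2)).
assert (HA : 0 <= A) by apply Rabs_pos.
(* After this delay [k (t - T1)] exceeds [2 A / e], and [1 + s <= exp s] is
   enough to bring the exponential term below [e / 2]. *)
exists (T1 + 2 * A / (k * e)); intros t Ht.
assert (HAk : 0 <= 2 * A / (k * e)).
{ apply Rmult_le_pos; [lra | apply Rlt_le, Rinv_0_lt_compat; nra]. }
assert (HTt : T1 < t) by lra.
destruct (MVT_between (fun s => exp (k * s) * (W s - e / 2))
  (fun s => exp (k * s) * (dW s + k * (W s - e / 2))) T1 t) as [z [Hz E]].
{ intros z Hz; rewrite Rmin_left in Hz by lra.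
  assert (Hz0 : 0 < z) by (unfold T1 in *; lra).
  specialize (HW z Hz0).
  auto_derive; [now exists (dW z) | ].
  replace (Derive (fun x => W x) z) with (dW z)
    by (symmetry; now apply is_derive_unique).
  ring. }
rewrite Rmin_left in Hz by lra.
assert (Hneg : dW z + k * (W z - e / 2) <= 0).
{ specialize (HT z ltac:(unfold T1 in *; lra)).
  apply Rabs_def2 in HT.
  specialize (Hle z ltac:(unfold T1 in *; lra)); lra. }
assert (Hexp : exp (k * t) * (W t - e / 2) <= exp (k * T1) * (W T1 - e / 2)).
{ pose proof (exp_pos (k * z)).
  assert (0 <= exp (k * z) * - (dW z + k * (W z - e / 2)) * (t - T1)).
  { apply Rmult_le_pos; [apply Rmult_le_pos | ]; lra. }
  lra. }
replace (k * t) with (k * T1 + k * (t - T1)) in Hexp by ring.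
rewrite exp_plus, Rmult_assoc in Hexp.
apply Rmult_le_reg_l in Hexp; [ | apply exp_pos].
assert (Hk1 : 1 + k * (t - T1) <= exp (k * (t - T1))) by apply exp_ineq1_le.
assert (HkA : 2 * A / e < k * (t - T1)).
{ replace (2 * A / e) with (k * (2 * A / (k * e))) by (field; lra).
  apply Rmult_lt_compat_l; lra. }
assert (HA2 : A < e / 2 * exp (k * (t - T1))).
{ replace A with (e / 2 * (2 * A / e)) at 1 by (field; lra).
  apply Rmult_lt_compat_l; lra. }
assert (W T1 - e / 2 <= A) by apply Rle_abs.
apply Rnot_le_lt; intro Hc.
pose proof (exp_pos (k * (t - T1))).
assert (exp (k * (t - T1)) * (e / 2) <= exp (k * (t - T1)) * (W t - e / 2))
  by (apply Rmult_le_compat_l; lra).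
lra.
Qed.

Lemma linear_filter_lim_0 (W eta : R -> R) (k : R) :
  0 < k ->
  (forall t, 0 < t -> is_derive W t (- k * W t + eta t)) ->
  is_lim eta p_infty 0 ->
  is_lim W p_infty 0.
Proof.
intros Hk HW Heta.
apply is_lim_0_of_eventually_small; intros e He.
destruct (decay_eventually_le W _ eta k Hk HW) with (e := e) as [T1 H1];
  auto using Rle_refl.
destruct (decay_eventually_le (fun t => - W t)
  (fun t => - (- k * W t + eta t)) (fun t => - eta t) k Hk) with (e := e)
  as [T2 H2]; auto.
- intros t Ht; apply (is_derive_opp W); auto.
- intros t Ht; lra.
- replace (Finite 0) with (Rbar_opp 0) by (simpl; f_equal; ring).
  now apply is_lim_opp.
- exists (Rmax T1 T2); intros t Ht.
  pose proof (Rmax_l T1 T2); pose proof (Rmax_r T1 T2).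
  specialize (H1 t ltac:(lra)); specialize (H2 t ltac:(lra)); simpl in H2.
  apply Rabs_def1; lra.
Qed.

(** * The threshold on the observer gain *)

Lemma quartic_positive_above (a b c d e : R) :
  0 < a -> exists B, 1 <= B /\
    forall w, B <= w -> 0 < a * w ^ 4 + b * w ^ 3 + c * w ^ 2 + d * w + e.
Proof.
intros Ha.
set (S := Rabs b + Rabs c + Rabs d + Rabs e + 1).
pose proof (Rabs_pos b); pose proof (Rabs_pos c);
  pose proof (Rabs_pos d); pose proof (Rabs_pos e).
assert (HS : 0 <= S / a).
{ apply Rmult_le_pos; [unfold S; lra | apply Rlt_le, Rinv_0_lt_compat, Ha]. }
exists (1 + S / a); split; [lra | intros w Hw].
assert (Haw : S < a * w).
{ replace S with (a * (S / a)) by (field; lra).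
  apply Rmult_lt_compat_l; lra. }
assert (Hw1 : 1 <= w) by lra.
assert (Hw2 : 1 <= w ^ 2) by nra.
assert (Hw3 : w <= w ^ 3) by nra.
assert (Hw23 : w ^ 2 <= w ^ 3) by nra.
assert (L : forall x, - Rabs x <= x)
  by (intro x; pose proof (Rle_abs (- x)); rewrite Rabs_Ropp in *; lra).
assert (M : forall x m, 0 <= m <= w ^ 3 -> - Rabs x * w ^ 3 <= x * m).
{ intros x m Hm.
  pose proof (Rmult_le_compat_r m _ _ (proj1 Hm) (L x)).
  pose proof (Rmult_le_compat_l _ _ _ (Rabs_pos x) (proj2 Hm)). lra. }
pose proof (M b (w ^ 3) ltac:(lra)). pose proof (M c (w ^ 2) ltac:(lra)).
pose proof (M d w ltac:(lra)). pose proof (M e 1 ltac:(lra)).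
assert (S * w ^ 3 < a * w * w ^ 3) by (apply Rmult_lt_compat_r; lra).
replace (a * w * w ^ 3) with (a * w ^ 4) in * by ring.
unfold S in *; lra.
Qed.

Lemma IVT_root (F : R -> R) (a b : R) :
  a <= b -> (forall x, continuity_pt F x) -> F a <= 0 -> 0 <= F b ->
  exists x, a <= x <= b /\ F x = 0.
Proof.
intros Hab HF Ha Hb.
destruct (IVT_gen F a b 0 HF) as [x [Hx E]].
- rewrite Rmin_left, Rmax_right; lra.
- rewrite Rmin_left, Rmax_right in Hx by lra; eauto.
Qed.

Definition threshold_quartic (L1 L2 kap kad w : R) : R :=
  n0 L1 L2 kap kad * w ^ 4 + n1 L1 L2 kap kad * w ^ 3
  + n2 L1 L2 kap kad * w ^ 2 + n3 L1 L2 kap kad * w + n4 L1 L2 kap kad.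

Lemma threshold_quartic_continuity (L1 L2 kap kad x : R) :
  continuity_pt (threshold_quartic L1 L2 kap kad) x.
Proof.
apply continuity_pt_filterlim.
apply (ex_derive_continuous (threshold_quartic L1 L2 kap kad)).
unfold threshold_quartic; auto_derive; trivial.
Qed.

(** The polynomial is positive far out, so its root set is bounded above; it is
    continuous, so it vanishes at the supremum of its roots. *)
Lemma Omega_has_max (L1 L2 kap kad w0 : R) :
  0 < kad -> Omega L1 L2 kap kad w0 ->
  exists m, is_max (Omega L1 L2 kap kad) m.
Proof.
intros hkad Hw0.
set (Q := threshold_quartic L1 L2 kap kad).
destruct (quartic_positive_above (n0 L1 L2 kap kad) (n1 L1 L2 kap kad)
  (n2 L1 L2 kap kad) (n3 L1 L2 kap kad) (n4 L1 L2 kap kad)) as [B [_ HB]].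
{ unfold n0; nra. }
destruct (completeness (Omega L1 L2 kap kad)) as [m [Hub Hlub]].
{ exists B; intros w Hw; apply Rnot_lt_le; intro Hlt.
  specialize (HB w (Rlt_le _ _ Hlt)); unfold Omega in Hw; lra. }
{ now exists w0. }
exists m; split; [ | exact Hub].
apply NNPP; intro Hm; change (Q m <> 0) in Hm.
destruct (threshold_quartic_continuity L1 L2 kap kad m (Rabs (Q m))) as [a [Ha Hc]].
{ now apply Rabs_pos_lt. }
assert (m <= m - a / 2); [ | lra].
apply Hlub; intros w Hw; apply Rnot_lt_le; intro Hlt.
pose proof (Hub w Hw); change (Q w = 0) in Hw.
assert (Hne : m <> w) by congruence.
specialize (Hc w); simpl in Hc; unfold Rdist in Hc; fold Q in Hc.
rewrite Hw in Hc.
assert (Rabs (0 - Q m) < Rabs (Q m)); [apply Hc | ].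
- repeat split; auto. apply Rabs_def1; lra.
- replace (0 - Q m) with (- Q m) in * by ring; rewrite Rabs_Ropp in *; lra.
Qed.

Lemma no_root_above_omega_star (L1 L2 kap kad wo w : R) :
  0 < kad -> omega_star L1 L2 kap kad < wo -> wo <= w ->
  ~ Omega L1 L2 kap kad w.
Proof.
intros hkad Hwo Hw HO.
destruct (Omega_has_max L1 L2 kap kad w hkad HO) as [m Hm].
assert (Hmax : is_max (Omega L1 L2 kap kad) (max_set (Omega L1 L2 kap kad)))
  by (unfold max_set; apply epsilon_spec; eauto).
assert (Hle : w <= max_set (Omega L1 L2 kap kad)) by (apply Hmax, HO).
unfold omega_star in Hwo.
pose proof (Rmax_l 0 (Rmax ((L1 - kap) / kad)
               (Rmax (L2 - kad) (omega_bar L1 L2 kap kad)))).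
pose proof (Rmax_r 0 (Rmax ((L1 - kap) / kad)
               (Rmax (L2 - kad) (omega_bar L1 L2 kap kad)))).
pose proof (Rmax_r ((L1 - kap) / kad)
               (Rmax (L2 - kad) (omega_bar L1 L2 kap kad))).
pose proof (Rmax_r (L2 - kad) (omega_bar L1 L2 kap kad)).
unfold omega_bar in *.
destruct excluded_middle_informative as [[Hn | Hn] | _].
- exact (Hn w HO).
- lra.
- lra.
Qed.

(** With [P w = (kap + w kad - L1) (kad + w - L2) - w kap], the quartic is
    [P w ^ 2 - L2 ^ 2 * (w kap) * (kad + w - L2)]. It has no root on
    [[wo, oo)] and is positive far out, hence positive at [wo]. At a root of [P] it
    would be negative, so [P] has no root on [[wo, oo)] either and is positive
    at [wo] for the same reason. *)
Lemma omega_star_conditions (L1 L2 kap kad wo : R) :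
  0 < L2 -> 0 < kap -> 0 < kad -> omega_star L1 L2 kap kad < wo ->
  let p := kap + wo * kad - L1 in
  let q := kad + wo - L2 in
  let c := wo * kap in
  0 < wo /\ 0 < p /\ 0 < q /\ c < p * q /\ L2 ^ 2 * (c * q) < (p * q - c) ^ 2.
Proof.
intros hL2 hkap hkad hwo p q c.
assert (H0 := hwo).
unfold omega_star in H0.
apply Rmax_Rlt in H0; destruct H0 as [H0 H1].
apply Rmax_Rlt in H1; destruct H1 as [H1 H2].
apply Rmax_Rlt in H2; destruct H2 as [H2 _].
assert (Hp : 0 < p).
{ apply (Rmult_lt_compat_r kad) in H1; [ | assumption].
  replace ((L1 - kap) / kad * kad) with (L1 - kap) in H1 by (field; lra).
  unfold p; lra. }
assert (Hq : 0 < q) by (unfold q; lra).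
set (P := fun w => kad * w ^ 2 + (kad * (kad - L2) - L1) * w
                   + (kap - L1) * (kad - L2)).
set (Q := threshold_quartic L1 L2 kap kad).
assert (HQ : forall w, Q w = P w ^ 2 - L2 ^ 2 * (w * kap * (kad + w - L2))).
{ intro w; unfold Q, threshold_quartic, P, n0, n1, n2, n3, n4; ring. }
assert (HPc : forall x, continuity_pt P x).
{ intro x; apply continuity_pt_filterlim, (ex_derive_continuous P); unfold P.
  auto_derive; trivial. }
destruct (quartic_positive_above (n0 L1 L2 kap kad) (n1 L1 L2 kap kad)
  (n2 L1 L2 kap kad) (n3 L1 L2 kap kad) (n4 L1 L2 kap kad)) as [B [_ HB]].
{ unfold n0; nra. }
assert (HQpos : forall w, wo <= w -> 0 < Q w).
{ intros w Hw; apply Rnot_le_lt; intro Hle.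
  pose proof (Rmax_l w B); pose proof (Rmax_r w B).
  destruct (IVT_root Q w (Rmax w B)) as [z [Hz E]]; auto.
  - apply threshold_quartic_continuity.
  - apply Rlt_le, HB; assumption.
  - apply (no_root_above_omega_star L1 L2 kap kad wo z hkad hwo); [lra | ].
    exact E. }
destruct (quartic_positive_above kad (kad * (kad - L2) - L1)
   ((kap - L1) * (kad - L2)) 0 0 hkad) as [B2 [HB21 HB2]].
assert (HPpos : 0 < P wo).
{ apply Rnot_le_lt; intro Hle.
  pose proof (Rmax_l wo B2); pose proof (Rmax_r wo B2).
  destruct (IVT_root P wo (Rmax wo B2)) as [z [Hz E]]; auto.
  - (* [HB2] bounds the quartic [m ^ 2 * P m]. *)
    specialize (HB2 (Rmax wo B2) ltac:(assumption)).
    set (m := Rmax wo B2) in *.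
    assert (0 < m ^ 2 * P m) by (unfold P; lra).
    assert (0 < m ^ 2) by nra.
    nra.
  - specialize (HQpos z (proj1 Hz)); rewrite HQ, E in HQpos.
    assert (0 < z * kap * (kad + z - L2)).
    { apply Rmult_lt_0_compat; [apply Rmult_lt_0_compat | ]; lra. }
    nra. }
assert (EP : p * q - c = P wo) by (unfold p, q, c, P; ring).
repeat split; auto.
- lra.
- rewrite EP; specialize (HQpos wo (Rle_refl _)); rewrite HQ in HQpos.
  unfold c, q; lra.
Qed.

(** * A strict Lyapunov function for the third-order equation *)

(** The last conclusion is a quadratic inequality in [mu]. The chosen [mu] is the
    extremal point of that quadratic, and the discriminant is positive exactly
    when [L ^ 2 c q < (p q - c) ^ 2]. Of the two ways for [mu p - c] and
    [q - mu] to have the same sign, [c < p q] excludes both being negative. *)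
Lemma multiplier_exists (p q c L : R) :
  0 < p -> 0 < q -> 0 < c -> c < p * q -> L ^ 2 * (c * q) < (p * q - c) ^ 2 ->
  exists mu, 0 < mu /\ 0 < mu * p - c /\ 0 < q - mu /\
    (L * mu) ^ 2 < 4 * (mu * p - c) * (q - mu).
Proof.
intros hp hq hc hpq hL.
set (s := 4 * p + L ^ 2).
assert (hs : 0 < s) by (unfold s; nra).
set (mu := 2 * (p * q + c) / s).
assert (Es : s * mu = 2 * (p * q + c)) by (unfold mu; field; lra).
assert (hmu : 0 < mu) by (apply Rdiv_lt_0_compat; nra).
assert (H : (L * mu) ^ 2 < 4 * (mu * p - c) * (q - mu)).
{ apply Rmult_lt_reg_l with s; [assumption | ].
  assert (E : s * (4 * (mu * p - c) * (q - mu)) - s * (L * mu) ^ 2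
    = 4 * (s * mu) * (p * q + c) - (s * mu) ^ 2 - 4 * s * (c * q))
    by (unfold s; ring).
  rewrite Es in E.
  assert (s * (c * q) < (p * q + c) ^ 2) by (unfold s; nra).
  nra. }
assert (H4 : 0 < (mu * p - c) * (q - mu)) by (pose proof (pow2_ge_0 (L * mu)); nra).
assert (H5 : 0 < q - mu).
{ apply Rnot_le_lt; intro Hle.
  assert (mu * p - c < 0) by nra.
  assert (p * q <= p * mu) by (apply Rmult_le_compat_l; lra). lra. }
exists mu; repeat split; auto.
apply Rmult_lt_reg_r with (q - mu); lra.
Qed.

Lemma definite_form_bound (A B D : R) :
  0 < A -> 0 < B -> 0 <= D -> D ^ 2 < 4 * A * B ->
  exists th, 0 < th /\ forall a b, 
    th * (a ^ 2 + b ^ 2) <= A * a ^ 2 + B * b ^ 2 - D * (Rabs a * Rabs b).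
Proof.
intros hA hB hD hAB.
(* With this value [4 (A - th) (B - th) = D ^ 2 + 4 th ^ 2]. *)
set (th := (4 * A * B - D ^ 2) / (4 * (A + B))).
assert (Eth : th * (4 * (A + B)) = 4 * A * B - D ^ 2) by (unfold th; field; lra).
assert (hth : 0 < th) by (apply Rdiv_lt_0_compat; lra).
assert (hAt : 0 < A - th) by nra.
exists th; split; [assumption | intros a b].
rewrite <- (pow2_abs a), <- (pow2_abs b).
set (x := Rabs a); set (z := Rabs b).
assert (E : 4 * (A - th) * (A * x ^ 2 + B * z ^ 2 - D * (x * z) - th * (x ^ 2 + z ^ 2))
  = (2 * (A - th) * x - D * z) ^ 2
    + (4 * A * B - D ^ 2 - th * (4 * (A + B)) + 4 * th ^ 2) * z ^ 2) by ring.
rewrite <- Eth in E.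
pose proof (pow2_ge_0 (2 * (A - th) * x - D * z)).
pose proof (pow2_ge_0 (th * z)).
apply Rnot_lt_le; intro Hlt. nra.
Qed.

Lemma triangular_form_coercive (a b c s t : R) :
  0 < a -> 0 < b -> 0 < c ->
  exists m, 0 < m /\ forall X y v,
    m * (X ^ 2 + y ^ 2 + v ^ 2)
      <= a * (X + s * y) ^ 2 + b * y ^ 2 + c * (v + t * y) ^ 2.
Proof.
intros ha hb hc.
set (k := 1 + 2 * s ^ 2 + 2 * t ^ 2).
assert (hk : 0 < k) by (unfold k; nra).
set (m := Rmin (Rmin (a / 2) (c / 2)) (b / k)).
assert (hbk : 0 < b / k) by (apply Rdiv_lt_0_compat; assumption).
assert (hm : 0 < m) by (repeat apply Rmin_pos; lra).
assert (m <= a / 2) by (eapply Rle_trans; [apply Rmin_l | apply Rmin_l]).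
assert (m <= c / 2) by (eapply Rle_trans; [apply Rmin_l | apply Rmin_r]).
assert (hmk : m * k <= b).
{ replace b with (b / k * k) by (field; lra).
  apply Rmult_le_compat_r; [lra | apply Rmin_r]. }
exists m; split; [assumption | intros X y v].
assert (X ^ 2 + y ^ 2 + v ^ 2
  <= 2 * (X + s * y) ^ 2 + k * y ^ 2 + 2 * (v + t * y) ^ 2).
{ pose proof (pow2_ge_0 (X + 2 * (s * y))).
  pose proof (pow2_ge_0 (v + 2 * (t * y))). unfold k; nra. }
pose proof (pow2_ge_0 (X + s * y)); pose proof (pow2_ge_0 y);
  pose proof (pow2_ge_0 (v + t * y)).
assert (m * (2 * (X + s * y) ^ 2 + k * y ^ 2 + 2 * (v + t * y) ^ 2)
   <= a * (X + s * y) ^ 2 + b * y ^ 2 + c * (v + t * y) ^ 2) by nra.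
nra.
Qed.

Lemma young (k a b : R) : 0 < k -> a * b <= k / 2 * a ^ 2 + b ^ 2 / (2 * k).
Proof.
intro hk.
assert (0 <= (k * a - b) ^ 2 / (2 * k)).
{ apply Rmult_le_pos; [apply pow2_ge_0 | apply Rlt_le, Rinv_0_lt_compat; lra]. }
replace ((k * a - b) ^ 2 / (2 * k))
  with (k / 2 * a ^ 2 + b ^ 2 / (2 * k) - a * b) in * by (field; lra).
lra.
Qed.

(** The classical Lyapunov function for x''' + a x'' + g(x') + c x = 0, with
    multiplier [mu] and [G] a primitive of [g]. The term in [eps] is there for
    strictness: without it the derivative along the motion has no negative term
    in the integral state [X]. *)
Definition lyapunov (mu c a eps : R) (G : R -> R) (X y v : R) : R :=
  mu * c / 2 * X ^ 2 + c * (X * y) + G y + v ^ 2 / 2 + mu * (y * v)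
  + mu * a / 2 * y ^ 2 + eps * (X * v).

Definition lyapunov_rate (mu c a eps g X y v dv : R) : R :=
  mu * c * (X * y) + c * (y * y + X * v) + g * v + v * dv
  + mu * (v * v + y * dv) + mu * a * (y * v) + eps * (y * v + X * dv).

Lemma primitive_sector_bounds (g : R -> R) (p K : R) :
  (forall z, continuous g z) ->
  (forall z, p * z ^ 2 <= z * g z) ->
  (forall z, Rabs (g z) <= K * Rabs z) ->
  exists G, (forall z, is_derive G z (g z)) /\
    (forall z, p / 2 * z ^ 2 <= G z <= K / 2 * z ^ 2).
Proof.
intros Hc Hp HK.
exists (fun z => RInt g 0 z).
assert (HD : forall z, is_derive (fun z => RInt g 0 z) z (g z)).
{ intro z; apply is_derive_RInt with (a := 0); [ | apply Hc].
  apply filter_forall; intro b; apply RInt_correct.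
  apply (ex_RInt_continuous g); intros; apply Hc. }
split; [exact HD | ].
assert (g0 : g 0 = 0).
{ specialize (HK 0); rewrite Rabs_R0, Rmult_0_r in HK.
  pose proof (Rabs_pos (g 0)).
  apply Rabs_eq_0; lra. }
assert (Hup : forall z, z * g z <= K * z ^ 2).
{ intro z. rewrite <- pow2_abs.
  pose proof (Rle_abs (z * g z)); rewrite Rabs_mult in *.
  pose proof (Rmult_le_compat_l _ _ _ (Rabs_pos z) (HK z)); lra. }
assert (Hpos : forall F dF : R -> R, F 0 = 0 -> dF 0 = 0 ->
  (forall z, is_derive F z (dF z)) -> (forall z, 0 <= z * dF z) ->
  forall z, 0 <= F z).
{ intros F dF F0 dF0 HF Hs z.
  destruct (MVT_between F dF 0 z) as [x [Hx E]]; [auto | ].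
  rewrite F0, !Rminus_0_r in E; rewrite E.
  destruct (Req_dec x 0) as [-> | Hne]; [rewrite dF0; lra | ].
  pose proof (Hs x).
  destruct (Rle_dec 0 z) as [Hz | Hz].
  - rewrite Rmin_left, Rmax_right in Hx by lra.
    apply Rmult_le_pos; [ | lra]. nra.
  - rewrite Rmin_right, Rmax_left in Hx by lra. 
    assert (dF x <= 0) by nra. nra. }
intro z; split.
- enough (0 <= RInt g 0 z - p / 2 * z ^ 2) by lra.
  apply (Hpos (fun z => RInt g 0 z - p / 2 * z ^ 2) (fun z => g z - p * z)).
  + rewrite RInt_point; unfold zero; simpl; ring.
  + rewrite g0; ring.
  + intro x; apply (is_derive_minus (fun z => RInt g 0 z)
      (fun z => p / 2 * z ^ 2)); [apply HD | ].
    auto_derive; [trivial | field].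
  + intro x; specialize (Hp x); lra.
- enough (0 <= K / 2 * z ^ 2 - RInt g 0 z) by lra.
  apply (Hpos (fun z => K / 2 * z ^ 2 - RInt g 0 z) (fun z => K * z - g z)).
  + rewrite RInt_point; unfold zero; simpl; ring.
  + rewrite g0; ring.
  + intro x; apply (is_derive_minus (fun z => K / 2 * z ^ 2)
      (fun z => RInt g 0 z)); [ | apply HD].
    auto_derive; [trivial | field].
  + intro x; specialize (Hup x); lra.
Qed.

Lemma lyapunov_is_derive (mu c a eps : R) (G g : R -> R) (X y v : R -> R) (t dv : R) :
  (forall z, is_derive G z (g z)) ->
  is_derive X t (y t) -> is_derive y t (v t) -> is_derive v t dv ->
  is_derive (fun s => lyapunov mu c a eps G (X s) (y s) (v s)) t
    (lyapunov_rate mu c a eps (g (y t)) (X t) (y t) (v t) dv).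
Proof.
intros HG HX Hy Hv; unfold lyapunov, lyapunov_rate.
auto_derive.
- repeat split; trivial; eexists; eauto.
- replace (Derive (fun x => X x) t) with (y t) by (symmetry; now apply is_derive_unique).
  replace (Derive (fun x => y x) t) with (v t) by (symmetry; now apply is_derive_unique).
  replace (Derive (fun x => v x) t) with dv by (symmetry; now apply is_derive_unique).
  replace (Derive (fun x => G x) (y t)) with (g (y t)) by (symmetry; now apply is_derive_unique).
  field.
Qed.

(** Since [G y] lies above [p / 2 * y ^ 2], completing squares in [X] and in [v]
    leaves [(mu p - c) / (2 mu) + mu (a - mu) / 2] as coefficient of [y ^ 2], which
    is positive. *)
Lemma lyapunov_bounds (mu c a p K : R) (G : R -> R) :
  0 < mu -> 0 < c -> 0 <= K -> 0 < mu * p - c -> mu < a -> 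
  (forall z, p / 2 * z ^ 2 <= G z <= K / 2 * z ^ 2) ->
  exists m M, 0 < m /\ 0 < M /\ forall eps, 0 <= eps <= m -> forall X y v,
    m / 2 * (X ^ 2 + y ^ 2 + v ^ 2) <= lyapunov mu c a eps G X y v
      <= M * (X ^ 2 + y ^ 2 + v ^ 2).
Proof.
intros hmu hc hK hp ha HG.
assert (hpc : 0 < p / 2 - c / (2 * mu)).
{ replace (p / 2 - c / (2 * mu)) with ((mu * p - c) / (2 * mu)) by (field; lra).
  apply Rdiv_lt_0_compat; lra. }
destruct (triangular_form_coercive (mu * c / 2)
  (p / 2 - c / (2 * mu) + mu * (a - mu) / 2) (1 / 2) (1 / mu) mu)
  as [m [hm Hm]]; [nra | nra | lra | ].
exists m, (mu * c + c + K + 1 + mu + mu * a + m).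
split; [assumption | split; [nra | ]].
intros eps heps X y v.
assert (HXv : Rabs (X * v) <= (X ^ 2 + v ^ 2) / 2).
{ apply Rabs_le; pose proof (pow2_ge_0 (X + v)); pose proof (pow2_ge_0 (X - v)); lra. }
apply Rabs_le_between in HXv.
assert (HyX : X * y <= (X ^ 2 + y ^ 2) / 2) by (pose proof (pow2_ge_0 (X - y)); lra).
assert (Hyv : y * v <= (y ^ 2 + v ^ 2) / 2) by (pose proof (pow2_ge_0 (y - v)); lra).
pose proof (pow2_ge_0 X); pose proof (pow2_ge_0 y); pose proof (pow2_ge_0 v).
specialize (HG y); unfold lyapunov; split.
- specialize (Hm X y v).
  assert (- (m * ((X ^ 2 + v ^ 2) / 2)) <= eps * (X * v)) by nra.
  replace (mu * c / 2 * (X + 1 / mu * y) ^ 2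
    + (p / 2 - c / (2 * mu) + mu * (a - mu) / 2) * y ^ 2 + 1 / 2 * (v + mu * y) ^ 2)
    with (mu * c / 2 * X ^ 2 + c * (X * y) + p / 2 * y ^ 2 + v ^ 2 / 2
      + mu * (y * v) + mu * a / 2 * y ^ 2) in Hm by (field; lra).
  nra.
- assert (eps * (X * v) <= m * ((X ^ 2 + v ^ 2) / 2)) by nra.
  assert (c * (X * y) <= c * ((X ^ 2 + y ^ 2) / 2)) by nra.
  assert (mu * (y * v) <= mu * ((y ^ 2 + v ^ 2) / 2)) by nra.
  assert (0 < mu * c) by nra. assert (0 < mu * a) by nra.
  assert (mu * c / 2 * X ^ 2 <= mu * c * X ^ 2) by nra.
  assert (mu * a / 2 * y ^ 2 <= mu * a * y ^ 2) by nra.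
  assert (0 <= mu * c * (y ^ 2 + v ^ 2)) by nra.
  assert (0 <= mu * a * (X ^ 2 + v ^ 2)) by nra.
  assert (0 <= K * (X ^ 2 + y ^ 2 / 2 + v ^ 2)) by nra.
  assert (0 <= c * (X ^ 2 / 2 + y ^ 2 / 2 + v ^ 2)) by nra.
  assert (0 <= mu * (X ^ 2 + y ^ 2 / 2 + v ^ 2 / 2)) by nra.
  assert (0 <= m * (X ^ 2 / 2 + y ^ 2 + v ^ 2 / 2)) by nra.
  nra.
Qed.

(** For [eps = 0] and [d = 0] the cross terms of the rate cancel down to
    [c y ^ 2 - mu y g - (a - mu) v ^ 2 + (v + mu y) b], which is at most
    [- (mu p - c) y ^ 2 - (a - L - mu) v ^ 2 + L mu |y| |v|], a negative
    definite form by the discriminant condition. A small [eps] adds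
    [- eps c X ^ 2] at the cost of terms absorbed by this form; Young's
    inequality absorbs [d]. *)
Lemma lyapunov_rate_bound (mu c a p K L : R) (m0 : R) :
  0 < mu -> 0 < c -> 0 < L -> 0 < m0 -> 0 < a - L - mu -> 0 < mu * p - c ->
  (L * mu) ^ 2 < 4 * (mu * p - c) * (a - L - mu) ->
  exists eps k C, 0 < eps <= m0 /\ 0 < k /\ 0 <= C /\
    forall X y v g b d,
      p * y ^ 2 <= y * g -> Rabs g <= K * Rabs y -> Rabs b <= L * Rabs v ->
      lyapunov_rate mu c a eps g X y v (- c * X - g - a * v + b + d)
        <= - k * (X ^ 2 + y ^ 2 + v ^ 2) + C * d ^ 2.
Proof.
intros hmu hc hL hm0 hq hp hdisc.
destruct (definite_form_bound (mu * p - c) (a - L - mu) (L * mu))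
  as [th [hth Hth]]; [lra | lra | nra | lra | ].
set (K2 := a + L).
set (S := 1 / 2 + K ^ 2 / c + K2 ^ 2 / c).
assert (hS : 0 < S).
{ unfold S.
  assert (0 <= K ^ 2 / c) by (apply Rdiv_le_0_compat; [apply pow2_ge_0 | lra]).
  assert (0 <= K2 ^ 2 / c) by (apply Rdiv_le_0_compat; [apply pow2_ge_0 | lra]).
  lra. }
set (eps := Rmin m0 (th / (2 * S))).
assert (heps : 0 < eps) by (apply Rmin_pos; [ | apply Rdiv_lt_0_compat]; lra).
assert (hepsS : eps * S <= th / 2).
{ replace (th / 2) with (th / (2 * S) * S) by (field; lra).
  apply Rmult_le_compat_r; [lra | apply Rmin_r]. }
set (k := Rmin (th / 2) (eps * c / 2)).
assert (hk : 0 < k) by (apply Rmin_pos; nra).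
assert (hk1 : k <= th / 2) by apply Rmin_l.
assert (hk2 : k <= eps * c / 2) by apply Rmin_r.
exists eps, (k / 2), ((1 + mu ^ 2 + eps ^ 2) / (2 * k)).
split; [split; [assumption | apply Rmin_l] | ].
split; [lra | ].
split; [apply Rdiv_le_0_compat; nra | ].
intros X y v g b d Hpg HK Hb.
assert (Hvb : v * b <= L * v ^ 2).
{ rewrite <- pow2_abs.
  pose proof (Rle_abs (v * b)); rewrite Rabs_mult in *.
  pose proof (Rmult_le_compat_l _ _ _ (Rabs_pos v) Hb); lra. }
assert (Hyb : y * b <= L * (Rabs y * Rabs v)).
{ pose proof (Rle_abs (y * b)); rewrite Rabs_mult in *.
  pose proof (Rmult_le_compat_l _ _ _ (Rabs_pos y) Hb); lra. }
assert (HX : - (X * g) - a * (X * v) + X * b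
   <= c / 2 * X ^ 2 + K ^ 2 / c * y ^ 2 + K2 ^ 2 / c * v ^ 2).
{ pose proof (young (c / 2) (Rabs X) (K * Rabs y) ltac:(lra)) as Y1.
  pose proof (young (c / 2) (Rabs X) (K2 * Rabs v) ltac:(lra)) as Y2.
  rewrite !Rpow_mult_distr, !pow2_abs in Y1, Y2.
  replace (K ^ 2 * y ^ 2 / (2 * (c / 2))) with (K ^ 2 / c * y ^ 2) in Y1 by (field; lra).
  replace (K2 ^ 2 * v ^ 2 / (2 * (c / 2))) with (K2 ^ 2 / c * v ^ 2) in Y2 by (field; lra).
  pose proof (Rle_abs (- (X * g))) as A1.
  pose proof (Rle_abs (- (X * v))) as A2.
  pose proof (Rle_abs (X * b)) as A3.
  rewrite Rabs_Ropp, Rabs_mult in A1, A2. rewrite Rabs_mult in A3.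
  pose proof (Rmult_le_compat_l _ _ _ (Rabs_pos X) HK).
  pose proof (Rmult_le_compat_l _ _ _ (Rabs_pos X) Hb).
  assert (a * - (X * v) <= a * (Rabs X * Rabs v)) by (apply Rmult_le_compat_l; lra).
  unfold K2 in *; lra. }
pose proof (young k v d hk) as D1.
pose proof (young k y (mu * d) hk) as D2.
pose proof (young k X (eps * d) hk) as D3.
assert (Hyv : y * v <= (y ^ 2 + v ^ 2) / 2) by (pose proof (pow2_ge_0 (y - v)); lra).
specialize (Hth y v).
unfold lyapunov_rate.
replace ((1 + mu ^ 2 + eps ^ 2) / (2 * k) * d ^ 2)
  with (d ^ 2 / (2 * k) + (mu * d) ^ 2 / (2 * k) + (eps * d) ^ 2 / (2 * k))
  by (field; lra).
pose proof (pow2_ge_0 X); pose proof (pow2_ge_0 y); pose proof (pow2_ge_0 v).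
apply (Rmult_le_compat_l mu) in Hyb; [ | lra].
apply (Rmult_le_compat_l mu) in Hpg; [ | lra].
assert (HE : eps * (y * v - (X * g) - a * (X * v) + X * b)
   <= eps * (c / 2) * X ^ 2 + eps * S * (y ^ 2 + v ^ 2)).
{ replace (eps * (c / 2) * X ^ 2 + eps * S * (y ^ 2 + v ^ 2))
    with (eps * (c / 2 * X ^ 2 + S * (y ^ 2 + v ^ 2))) by ring.
  apply Rmult_le_compat_l; [lra | ].
  assert (0 <= K ^ 2 / c * v ^ 2)
    by (apply Rmult_le_pos; [apply Rdiv_le_0_compat | ]; auto using pow2_ge_0).
  assert (0 <= K2 ^ 2 / c * y ^ 2)
    by (apply Rmult_le_pos; [apply Rdiv_le_0_compat | ]; auto using pow2_ge_0).
  unfold S; lra. }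
assert (eps * S * (y ^ 2 + v ^ 2) <= th / 2 * (y ^ 2 + v ^ 2))
  by (apply Rmult_le_compat_r; lra).
assert (k * (y ^ 2 + v ^ 2) <= th / 2 * (y ^ 2 + v ^ 2))
  by (apply Rmult_le_compat_r; lra).
assert (k * X ^ 2 <= eps * c / 2 * X ^ 2) by (apply Rmult_le_compat_r; lra).
lra.
Qed.

(** The perturbation [b] stands for the dependence of the nonlinearity on the
    velocity: it need not decay, but is within the gain [L] of [v]. *)
Lemma third_order_convergence (c a p K L : R) (g : R -> R)
    (X y v b d : R -> R) :
  0 < c -> 0 < p -> 0 < L -> 0 < a - L -> 0 <= K ->
  c < p * (a - L) -> L ^ 2 * (c * (a - L)) < (p * (a - L) - c) ^ 2 ->
  (forall z, continuous g z) ->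
  (forall z, p * z ^ 2 <= z * g z) ->
  (forall z, Rabs (g z) <= K * Rabs z) ->
  (forall t, 0 < t -> is_derive X t (y t)) ->
  (forall t, 0 < t -> is_derive y t (v t)) ->
  (forall t, 0 < t ->
     is_derive v t (- c * X t - g (y t) - a * v t + b t + d t)) ->
  (forall t, 0 < t -> Rabs (b t) <= L * Rabs (v t)) ->
  is_lim d p_infty 0 ->
  is_lim y p_infty 0 /\ is_lim v p_infty 0.
Proof.
intros hc hp hL hq hK hpq hdisc Hg Hp HK HX Hy Hv Hb Hd.
destruct (multiplier_exists p (a - L) c L) as [mu [hmu [hmup [hmuq hmuL]]]]; auto.
destruct (primitive_sector_bounds g p K) as [G [HG HGb]]; auto.
destruct (lyapunov_bounds mu c a p K G) as [m [M [hm [hM HmM]]]]; auto; [lra | ].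
destruct (lyapunov_rate_bound mu c a p K L m) as [eps [k [C [heps [hk [hC Hrate]]]]]];
  auto.
specialize (HmM eps ltac:(lra)).
set (W := fun t => lyapunov mu c a eps G (X t) (y t) (v t)).
assert (HW : forall e, 0 < e -> exists T, forall t, T < t -> W t < e).
{ eapply decay_eventually_le with (k := k / M) (eta := fun t => C * (d t * d t)).
  - apply Rdiv_lt_0_compat; assumption.
  - intros t Ht; apply lyapunov_is_derive with (g := g); auto.
  - intros t Ht; simpl.
    eapply Rle_trans; [apply Hrate; auto | ].
    apply Rplus_le_compat; [ | simpl; lra].
    destruct (HmM (X t) (y t) (v t)) as [_ H].
    apply (Rmult_le_compat_l (k / M)) in H;
      [ | apply Rlt_le, Rdiv_lt_0_compat; assumption].
    replace (k / M * (M * (X t ^ 2 + y t ^ 2 + v t ^ 2)))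
      with (k * (X t ^ 2 + y t ^ 2 + v t ^ 2)) in H by (field; lra).
    unfold W; lra.
  - replace (Finite 0) with (Rbar_mult C 0) by (simpl; f_equal; ring).
    apply is_lim_scal_l.
    replace (Finite 0) with (Finite (0 * 0)) by (f_equal; ring).
    now apply (is_lim_mult d d p_infty 0 0). }
assert (Hcomp : forall z : R -> R, 
  (forall t, z t ^ 2 <= X t ^ 2 + y t ^ 2 + v t ^ 2) -> is_lim z p_infty 0).
{ intros z Hz; apply is_lim_0_of_eventually_small; intros e He.
  destruct (HW (m / 2 * e ^ 2)) as [T HT]; [apply Rmult_lt_0_compat; [lra | now apply pow_lt] | ].
  exists T; intros t Ht; specialize (HT t Ht).
  destruct (HmM (X t) (y t) (v t)) as [H _]; fold (W t) in H.
  specialize (Hz t).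
  rewrite <- (Rabs_pos_eq e) by lra.
  apply Rsqr_lt_abs_0; rewrite !Rsqr_pow2.
  apply Rmult_lt_reg_l with (m / 2); [lra | ].
  assert (m / 2 * z t ^ 2 <= m / 2 * (X t ^ 2 + y t ^ 2 + v t ^ 2))
    by (apply Rmult_le_compat_l; lra).
  lra. }
split; apply Hcomp; intro t;
  pose proof (pow2_ge_0 (X t)); pose proof (pow2_ge_0 (y t));
  pose proof (pow2_ge_0 (v t)); lra.
Qed.

(** * Convergence of the closed loop *)

(** The filter has a double pole at [- cr], so it is a cascade of two first-order
    filters: [dr + cr (r - yss)] is driven by [y - yss], and it drives
    [r - yss]. *)
Lemma transient_process_lim (cr : R) (y : R -> R) (yss x10 x20 : R)
    (r dr ddr : R -> R) :
  0 < cr -> is_lim y p_infty yss ->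
  transient_process cr y x10 x20 r dr ddr ->
  is_lim (fun t => r t - yss) p_infty 0 /\ is_lim dr p_infty 0.
Proof.
intros hcr hy [Hr [Hdr [Hdd _]]].
assert (Hq : is_lim (fun t => dr t + cr * (r t - yss)) p_infty 0).
{ apply linear_filter_lim_0 with (k := cr) (eta := fun t => cr ^ 2 * (y t - yss));
    [assumption | | now apply is_lim_scal_0, is_lim_sub_const].
  intros t Ht.
  pose proof (derivative_on_Rplus_is_derive _ _ t Hr Ht) as H1.
  pose proof (derivative_on_Rplus_is_derive _ _ t Hdr Ht) as H2.
  auto_derive; [repeat split; trivial; eexists; eauto | ].
  replace (Derive (fun x => r x) t) with (dr t)
    by (symmetry; now apply is_derive_unique).
  replace (Derive (fun x => dr x) t) with (ddr t)
    by (symmetry; now apply is_derive_unique).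
  rewrite Hdd by lra; ring. }
assert (Hs : is_lim (fun t => r t - yss) p_infty 0).
{ apply linear_filter_lim_0 with (k := cr)
    (eta := fun t => dr t + cr * (r t - yss)); [assumption | | exact Hq].
  intros t Ht.
  pose proof (derivative_on_Rplus_is_derive _ _ t Hr Ht) as H1.
  auto_derive; [eexists; eauto | ].
  replace (Derive (fun x => r x) t) with (dr t)
    by (symmetry; now apply is_derive_unique).
  ring. }
split; [exact Hs | ].
apply is_lim_ext with (fun t => dr t + cr * (r t - yss) - cr * (r t - yss)).
- intro; ring.
- replace (Finite 0) with (Finite (0 - 0)) by (f_equal; ring).
  apply is_lim_minus'; [exact Hq | now apply is_lim_scal_0].
Qed.

Theorem theorem1 (L1 L2 L3 kap kad cr wo : R)
    (hL1 : 0 < L1) (hL2 : 0 < L2) (hL3 : 0 < L3)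
    (hkap : 0 < kap) (hkad : 0 < kad) (hcr : 0 < cr)
    (f : R -> R -> R -> R) (hf : class_F L1 L2 L3 f)
    (hwo : omega_star L1 L2 kap kad < wo)
    (y : R -> R) (yss : R) (hy : reference_signal y yss)
    (x1 x2 xi fhat u r dr ddr : R -> R)
    (hr : transient_process cr y (x1 0) (x2 0) r dr ddr)
    (hplant : plant f u x1 x2)
    (hobs : observer wo x2 u xi fhat)
    (hctrl : control_law kap kad x1 x2 r dr ddr fhat u) :
  is_lim x1 p_infty yss /\ is_lim x2 p_infty 0.
Proof.
destruct (omega_star_conditions L1 L2 kap kad wo hL2 hkap hkad hwo)
  as [hwo0 [hp [hq [hpq hdisc]]]].
destruct hy as [_ [hylim _]].
destruct (transient_process_lim _ _ _ _ _ _ _ _ hcr hylim hr) as [hrlim hdrlim].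
destruct hr as [hr1 [hr2 _]].
destruct hplant as [hx1 hx2]; destruct hobs as [hxi [_ hfhat]].
destruct hf as [_ [h [w [dw [hfh [hh1 [hh2 [_ [_ [winf hw]]]]]]]]]].
set (kp := kap + wo * kad).
set (g := fun z => kp * z - (h (yss + z) 0 - h yss 0)).
set (Y := fun t => x1 t - r t).
set (V := fun t => x2 t - dr t).
(* Differentiating [fhat - wo V - wo kad Y] gives [wo kap Y]: up to the constant
   that compensates the limiting disturbance, [X] is the integral of [Y]. *)
set (X := fun t => (xi t + wo * x2 t - wo * (x2 t - dr t)
   - wo * kad * (x1 t - r t) - (h yss 0 + winf)) / (wo * kap)).
set (b := fun t => h (yss + Y t) (V t) - h (yss + Y t) 0).
set (d := fun t => (h (x1 t) (x2 t) - h (yss + Y t) (V t)) + (w t - winf)).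
assert (hlip1 : forall z a a', Rabs (h a' z - h a z) <= L1 * Rabs (a' - a)).
{ intro z; apply (lipschitz_of_derive_bound (fun a => h a z)); intro a; apply hh1. }
assert (hlip2 : forall z a a', Rabs (h z a' - h z a) <= L2 * Rabs (a' - a)).
{ intro z; apply (lipschitz_of_derive_bound (fun a => h z a)); intro a; apply hh2. }
assert (hd : is_lim d p_infty 0).
{ apply is_lim_abs_le_0
    with (fun t => L1 * Rabs (r t - yss) + L2 * Rabs (dr t) + Rabs (w t - winf)).
  - intros t _; unfold d.
    replace (h (x1 t) (x2 t) - h (yss + Y t) (V t))
      with ((h (x1 t) (x2 t) - h (yss + Y t) (x2 t))
            + (h (yss + Y t) (x2 t) - h (yss + Y t) (V t))) by ring.
    eapply Rle_trans; [apply Rabs_triang | apply Rplus_le_compat_r].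
    eapply Rle_trans; [apply Rabs_triang | apply Rplus_le_compat].
    + eapply Rle_trans; [apply hlip1 | right].
      do 2 f_equal; unfold Y; ring.
    + eapply Rle_trans; [apply hlip2 | right].
      do 2 f_equal; unfold V; ring.
  - replace (Finite 0) with (Finite (0 + 0 + 0)) by (f_equal; ring).
    assert (habs : forall s, is_lim s p_infty 0 -> is_lim (fun t => Rabs (s t)) p_infty 0).
    { intros s Hs; apply is_lim_0_of_eventually_small; intros e He.
      destruct (eventually_small s e Hs He) as [T [_ HT]].
      exists T; intros t Ht; rewrite Rabs_Rabsolu; auto. }
    repeat apply is_lim_plus';
      [apply is_lim_scal_0 | apply is_lim_scal_0 | ]; apply habs; auto.
    now apply is_lim_sub_const. }
(* The gains are those of the equivalent PID law: [wo kap] integral, [kp]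
   proportional, [kad + wo] derivative. *)
destruct (third_order_convergence (wo * kap) (kad + wo) (kp - L1) (kp + L1) L2
  g X Y V b d) as [HY HV]; auto.
- now apply Rmult_lt_0_compat.
- unfold kp; nra.
- intro z; unfold g.
  apply (ex_derive_continuous (fun z => kp * z - (h (yss + z) 0 - h yss 0))).
  auto_derive; repeat split; trivial; apply (hh1 (yss + z) 0).
- intro z; unfold g.
  pose proof (hlip1 0 yss (yss + z)) as H.
  replace (yss + z - yss) with z in H by ring.
  pose proof (Rle_abs (z * (h (yss + z) 0 - h yss 0))) as H1.
  rewrite Rabs_mult in H1.
  pose proof (Rmult_le_compat_l _ _ _ (Rabs_pos z) H).
  rewrite <- (pow2_abs z) at 1.
  replace (z * (kp * z - (h (yss + z) 0 - h yss 0)))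
    with (kp * z ^ 2 - z * (h (yss + z) 0 - h yss 0)) by ring.
  rewrite <- (pow2_abs z). lra.
- intro z; unfold g.
  pose proof (hlip1 0 yss (yss + z)) as H.
  replace (yss + z - yss) with z in H by ring.
  eapply Rle_trans; [apply Rabs_triang | ].
  rewrite Rabs_Ropp, Rabs_mult, (Rabs_pos_eq kp) by (unfold kp; nra). lra.
- intros t Ht.
  pose proof (derivative_on_Rplus_is_derive _ _ t hr1 Ht).
  pose proof (derivative_on_Rplus_is_derive _ _ t hr2 Ht).
  pose proof (derivative_on_Rplus_is_derive _ _ t hx1 Ht).
  pose proof (derivative_on_Rplus_is_derive _ _ t hx2 Ht).
  pose proof (derivative_on_Rplus_is_derive _ _ t hxi Ht).
  unfold X; auto_derive; [repeat split; trivial; eexists; eauto | ].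
  repeat match goal with H : is_derive ?F t ?l |- _ =>
    progress (replace (Derive (fun s => F s) t) with l
      by (symmetry; now apply is_derive_unique)) end.
  rewrite hctrl, hfhat by lra; unfold Y; field; lra.
- intros t Ht.
  pose proof (derivative_on_Rplus_is_derive _ _ t hr1 Ht).
  pose proof (derivative_on_Rplus_is_derive _ _ t hx1 Ht).
  apply (is_derive_minus x1 r); assumption.
- intros t Ht.
  pose proof (derivative_on_Rplus_is_derive _ _ t hr2 Ht).
  pose proof (derivative_on_Rplus_is_derive _ _ t hx2 Ht) as H2.
  cbv beta in H2; rewrite hfh, hctrl, hfhat in H2 by lra.
  evar_last; [apply (is_derive_minus x2 dr); eassumption | ].
  unfold minus, plus, opp; simpl.
  unfold g, d, b, X, Y, V, kp; field; lra.
- intros t _; unfold b.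
  eapply Rle_trans; [apply hlip2 | right; do 2 f_equal; ring].
- split.
  + apply is_lim_ext with (fun t => Y t + (r t - yss) + yss).
    { intro t; unfold Y; ring. }
    replace (Finite yss) with (Finite (0 + 0 + yss)) by (f_equal; ring).
    repeat apply is_lim_plus'; auto; apply is_lim_const.
  + apply is_lim_ext with (fun t => V t + dr t).
    { intro t; unfold V; ring. }
    replace (Finite 0) with (Finite (0 + 0)) by (f_equal; ring).
    now apply is_lim_plus'.
Qed.
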